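(* Let $\langle\mathbb{S},\to\rangle$ be a total transition system and $M=\mathscr{M}_\to$. For every $S\subseteq\mathbb{S}$, $\gamma^\forall_M(S)$ is not a fixpoint of the complete core $\mathrm{core}_{\oplus}(\rho^\forall_M)$ if and only if there exist $k>0$, $q\in S$, $r\in\mathbb{S}\setminus S$ and $t\in\mathbb{S}$ such that $q\xrightarrow{k}t$ and $r\xrightarrow{k}t$.
   Context: $\mathbb{T}$ is the set of traces $\langle i,\sigma\rangle$, $i\in\mathbb{Z}$, $\sigma:\mathbb{Z}\to\mathbb{S}$; $X_{\downarrow s}=\{\langle i,\sigma\rangle\in X\mid\sigma_i=s\}$; $\oplus(X)=\{\langle i,\sigma\rangle\mid\langle i+1,\sigma\rangle\in X\}$. A total transition system $\langle\mathbb{S},\to\rangle$: $\to\subseteq\mathbb{S}\times\mathbb{S}$, every state has a successor and a predecessor; $\mathscr{M}_\to=\{\langle i,\sigma\rangle\mid\forall k\in\mathbb{Z}.\ \sigma_k\to\sigma_{k+1}\}$. For $k>0$, $r\xrightarrow{k}s$ means there are $r_0=r,r_1,\dots,r_k=s$ with $r_j\to r_{j+1}$ for all $j<k$. $\gamma^\forall_M(S)=\{\langle i,\sigma\rangle\in M\mid\sigma_i\in S\}$; $\rho^\forall_M(X)=\{\langle i,\sigma\rangle\in M\mid M_{\downarrow\sigma_i}\subseteq X\}$. Upper closure operators on $\langle\wp(\mathbb{T}),\supseteq\rangle$: maps monotone w.r.t. $\subseteq$, idempotent, with $\rho(X)\subseteq X$; $\rho\sqsubseteq\eta$ iff $\rho(X)\supseteq\eta(X)$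 for all $X$. $\eta$ is complete for $\oplus$ if $\eta\circ\oplus=\eta\circ\oplus\circ\eta$. $\mathrm{core}_{\oplus}(\rho^\forall_M)$ is the $\sqsubseteq$-least closure $\eta$ with $\rho^\forall_M\sqsubseteq\eta$ that is complete for $\oplus$. *)

(* Defs.v *)
From mathcomp Require Import all_boot all_order all_algebra.
From mathcomp Require Import boolp classical_sets.

Set Implicit Arguments.
Unset Strict Implicit.
Unset Printing Implicit Defensive.

Import GRing.Theory.
Local Open Scope classical_set_scope.
Local Open Scope ring_scope.

Section Traces.
Variable State : Type.

Definition trace : Type := (int * (int -> State))%type.

Definition restrict_state (X : set trace) (s : State) : set trace :=
  [set x | X x /\ x.2 x.1 = s].

Definition next_trace (X : set trace) : set trace := [set x | X (x.1 + 1, x.2)].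

Definition gamma_forall (M : set trace) (S : set State) : set trace :=
  [set x | M x /\ S (x.2 x.1)].

Definition rho_forall (M : set trace) (X : set trace) : set trace :=
  [set x | M x /\ restrict_state M (x.2 x.1) `<=` X].

(* Upper closures for the order [⊇]: "extensive" means [rho X `<=` X]. *)
Definition is_uco (rho : set trace -> set trace) : Prop :=
  [/\ forall X Y, X `<=` Y -> rho X `<=` rho Y,
      forall X, rho (rho X) = rho X &
      forall X, rho X `<=` X].

Definition uco_le (rho eta : set trace -> set trace) : Prop :=
  forall X, eta X `<=` rho X.

Definition complete_for (f eta : set trace -> set trace) : Prop :=
  eta \o f = eta \o f \o eta.

Definition is_complete_core (f rho core : set trace -> set trace) : Prop :=
  [/\ is_uco core, uco_le rho core, complete_for f core &
      forall eta, is_uco eta -> uco_le rho eta -> complete_for f eta ->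
        uco_le core eta].

(* Junk value [rho] when no complete core exists; by [complete_core_next_traceP] this
   does not occur for [f = next_trace] and [rho] a closure. *)
Definition complete_core (f rho : set trace -> set trace) :
    set trace -> set trace :=
  xget rho [set core | is_complete_core f rho core].

Section Existence.

Let prevn (n : nat) (X : set trace) : set trace :=
  [set x | X (x.1 - n%:Z, x.2)].

Let shift_fix (rho : set trace -> set trace) (Y : set trace) : Prop :=
  forall n, rho (prevn n Y) = prevn n Y.

Let core_of (rho : set trace -> set trace) (X : set trace) : set trace :=
  [set x | exists Y, [/\ shift_fix rho Y, Y `<=` X & Y x]].

Let prevn0 X : prevn 0 X = X.
Proof.
by rewrite predeqE => -[i s]; rewrite /prevn /= subr0.
Qed.

Let prevnS n X : prevn n (prevn 1 X) = prevn n.+1 X.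
Proof.
by rewrite predeqE => -[i s]; rewrite /prevn /= -addrA -opprD -PoszD addn1.
Qed.

Let prev1K X : next_trace (prevn 1 X) = X.
Proof. by rewrite predeqE => -[i s]; rewrite /prevn /next_trace /= addrK. Qed.

Lemma exists_complete_core_next_trace (rho : set trace -> set trace) :
  is_uco rho -> exists core, is_complete_core next_trace rho core.
Proof.
move=> [rho_mono rho_idem rho_sub]; exists (core_of rho).
have core_sub X : core_of rho X `<=` X by move=> x [Y [_ YX Yx]]; exact: YX.
have core_mono X Y : X `<=` Y -> core_of rho X `<=` core_of rho Y.
  by move=> XY x [Z [fZ ZX Zx]]; exists Z; split=> // y /ZX /XY.
have core_fix X : shift_fix rho (core_of rho X).
  move=> n; apply/seteqP; split; first exact: rho_sub.
  move=> -[i s] /= [Y [fY YX Yx]].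
  have : rho (prevn n Y) (i, s) by rewrite fY.
  by apply: rho_mono => -[j u] /= Yj; exists Y.
have fixE X Y : shift_fix rho Y -> Y `<=` X -> Y `<=` core_of rho X.
  by move=> fY YX y Yy; exists Y.
split.
- split=> // X; apply/seteqP; split; first exact: core_sub.
  by apply: fixE.
- move=> X x Cx.
  have := core_fix X 0; rewrite !prevn0 => fC.
  by move: Cx; rewrite -fC; apply: rho_mono; exact: core_sub.
- apply/funext => X /=; apply/seteqP; split; last first.
    by apply: core_mono => -[i s] /=; exact: core_sub.
  apply: fixE; first exact: core_fix.
  move=> -[i s] /= Cis; rewrite /next_trace /=.
  exists (prevn 1 (core_of rho (next_trace X))); split.
  + by move=> n; rewrite prevnS; exact: core_fix.
  + move=> -[j u] /= /core_sub; by rewrite /next_trace /= subrK.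
  + by rewrite /prevn /= addrK.
- move=> eta [eta_mono eta_idem eta_sub] rho_eta eta_next X.
  have eta_fix Y : eta Y = Y -> eta (prevn 1 Y) = prevn 1 Y.
    move=> EY; apply/seteqP; split; first exact: eta_sub.
    have := congr1 (fun g => g (prevn 1 Y)) eta_next.
    rewrite /= prev1K EY => E -[i s] Yis.
    have : eta (next_trace (eta (prevn 1 Y))) (i - 1, s) by rewrite -E.
    by move/eta_sub; rewrite /next_trace /= subrK.
  apply: fixE; last exact: eta_sub.
  move=> n; apply/seteqP; split; first exact: rho_sub.
  have {}eta_fix : forall Y, eta Y = Y -> eta (prevn n Y) = prevn n Y.
    elim: n => [|n IHn] Y EY; first by rewrite prevn0.
    by rewrite -prevnS; apply: IHn; exact: eta_fix.
  by rewrite -{1}eta_fix //; exact: rho_eta.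
Qed.

End Existence.

Lemma complete_core_next_traceP (rho : set trace -> set trace) :
  is_uco rho -> is_complete_core next_trace rho (complete_core next_trace rho).
Proof. by move=> /exists_complete_core_next_trace [core hc]; exact: (xgetI rho hc). Qed.

Lemma rho_forall_uco (M : set trace) : is_uco (rho_forall M).
Proof.
have sub X : rho_forall M X `<=` X by move=> x [Mx]; exact.
split=> // [X Y XY x [Mx h]|X]; first by split=> // y /h /XY.
apply/seteqP; split=> [|x [Mx h]]; first exact: sub.
split=> // y [My Ey]; split=> // z [Mz Ez].
by apply: h; split; rewrite // Ez.
Qed.

End Traces.

Section Transitions.
Variables (State : Type) (trans : State -> State -> Prop).

Definition total_transition : Prop :=
  (forall s, exists t, trans s t) /\ (forall t, exists s, trans s t).

Definition traces_of : set (trace State) :=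
  [set x | forall k : int, trans (x.2 k) (x.2 (k + 1))].

(* Only the values [p 0], ..., [p k] of the path matter. *)
Definition steps (k : nat) (r s : State) : Prop :=
  exists p : nat -> State,
    [/\ p 0%N = r, p k = s & forall j, (j < k)%N -> trans (p j) (p j.+1)].

End Transitions.

(* Main.v *)
(** A set [Y] is a fixpoint of the complete core for [next_trace] iff every
    iterated backward shift [Y_n = {<i, sigma> | <i - n, sigma> in Y}] is a
    fixpoint of [rho]: completeness makes the fixpoints closed under backward
    shift, and the unions of the [Y_n] are the fixpoints of a complete closure.
    For [Y = gamma_forall M S], the set [Y_n] consists of the traces of [M] whose
    state [n] steps before the present is in [S]. It fails to be a fixpoint of
    [rho_forall M] exactly when two traces with the same present state [t]
    disagree on [S] at [n] steps before; as every finite path extends to a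
    bi-infinite trace, this means that [t] is reached in [n] steps both from [S]
    and from its complement, and [n = 0] is impossible. *)

Require Import Defs.
From mathcomp Require Import all_boot all_order all_algebra.
From mathcomp Require Import boolp classical_sets.

Set Implicit Arguments.
Unset Strict Implicit.
Unset Printing Implicit Defensive.

Import GRing.Theory.
Local Open Scope classical_set_scope.
Local Open Scope ring_scope.

Section CoreFixpoints.
Variable State : Type.
Implicit Types (X Y : set (trace State)).
Implicit Types (rho eta : set (trace State) -> set (trace State)).

Definition prev_trace (n : nat) X : set (trace State) :=
  [set x | X (x.1 - n%:Z, x.2)].

Lemma prev_trace0 X : prev_trace 0 X = X.
Proof. by rewrite predeqE => -[i s]; rewrite /prev_trace /= subr0. Qed.

Lemma prev_traceS n X : prev_trace n (prev_trace 1 X) = prev_trace n.+1 X.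
Proof.
by rewrite predeqE => -[i s]; rewrite /prev_trace /= -addrA -opprD -PoszD addn1.
Qed.

Lemma prev_trace1K X : next_trace (prev_trace 1 X) = X.
Proof.
by rewrite predeqE => -[i s]; rewrite /prev_trace /next_trace /= addrK.
Qed.

Lemma next_traceK X : prev_trace 1 (next_trace X) = X.
Proof.
by rewrite predeqE => -[i s]; rewrite /prev_trace /next_trace /= subrK.
Qed.

Lemma next_trace_mono X Y : X `<=` Y -> next_trace X `<=` next_trace Y.
Proof. by move=> XY x; exact: XY. Qed.

Lemma prev_trace_mono n X Y : X `<=` Y -> prev_trace n X `<=` prev_trace n Y.
Proof. by move=> XY x; exact: XY. Qed.

Lemma next_prev_traceS n X : next_trace (prev_trace n.+1 X) = prev_trace n X.
Proof.
rewrite predeqE => -[i s].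
by rewrite /prev_trace /next_trace /= -addn1 PoszD opprD addrACA subrr addr0.
Qed.

(** Completeness at [prev_trace 1 Y] turns [eta Y = Y] into [Y = eta (next_trace (eta (prev_trace 1
    Y)))]; dropping the outer [eta] and shifting back gives the case of one shift. *)
Lemma complete_fix_prev_trace eta Y n :
  is_uco eta -> complete_for (@next_trace State) eta ->
  eta Y = Y -> eta (prev_trace n Y) = prev_trace n Y.
Proof.
move=> [_ _ eta_sub] eta_next; elim: n Y => [|n IHn] Y EY.
  by rewrite prev_trace0.
rewrite -prev_traceS; apply: IHn; apply/seteqP; split; first exact: eta_sub.
have /= := congr1 (fun g => g (prev_trace 1 Y)) eta_next.
rewrite prev_trace1K EY => {1}->.
rewrite -[X in _ `<=` X]next_traceK.
by apply: prev_trace_mono; exact: eta_sub.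
Qed.

(** The closure whose fixpoints are the unions of backward shifts of [Y]; it competes with the core
    in the minimality argument. *)
Definition prev_closure Y X : set (trace State) :=
  [set x | exists2 n, prev_trace n Y `<=` X & prev_trace n Y x].

Lemma prev_closure_uco Y : is_uco (prev_closure Y).
Proof.
have sub X : prev_closure Y X `<=` X by move=> x [n YX /YX].
split=> // [X Z XZ x [n YX Yx]|X].
  by exists n => // y /YX /XZ.
apply/seteqP; split; first exact: sub.
by move=> x [n YX Yx]; exists n => // y Yy; exists n.
Qed.

Lemma prev_closure_complete Y :
  complete_for (@next_trace State) (prev_closure Y).
Proof.
have [mono _ sub] := prev_closure_uco Y.
apply/funext => X /=; apply/seteqP; split; last first.
  by apply: mono; apply: next_trace_mono; exact: sub.
move=> x [n YX Yx]; exists n => //.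
(* A shift of index [n] inside [next_trace X] comes from the shift of index [n.+1] inside [X]. *)
rewrite -next_prev_traceS; apply: next_trace_mono => y Yy; exists n.+1 => //.
have -> : prev_trace n.+1 Y = prev_trace 1 (prev_trace n Y).
  by rewrite -(next_prev_traceS n) next_traceK.
by rewrite -[X in _ `<=` X]next_traceK; exact: prev_trace_mono.
Qed.

Lemma complete_core_fixP rho Y : is_uco rho ->
  complete_core (@next_trace State) rho Y = Y <->
  forall n, prev_trace n Y `<=` rho (prev_trace n Y).
Proof.
move=> rho_uco; have [rho_mono _ _] := rho_uco.
have [core_uco rho_core core_next core_min] := complete_core_next_traceP rho_uco.
split=> [fixY n|fixY].
  by rewrite -{1}(complete_fix_prev_trace n core_uco core_next fixY).
apply/seteqP; split; first by have [_ _] := core_uco.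
have YC : Y `<=` prev_closure Y Y by move=> x Yx; exists 0%N; rewrite prev_trace0.
(* Minimality bounds [prev_closure Y Y], which contains [Y], by the core at [Y]. *)
apply: subset_trans YC _; apply: core_min.
- exact: prev_closure_uco.
- by move=> X x [n YX /fixY]; exact: rho_mono.
- exact: prev_closure_complete.
Qed.

End CoreFixpoints.

Section TransitionTraces.
Variables (State : Type) (trans : State -> State -> Prop).
Implicit Types (i : int) (sigma : int -> State).

Lemma traces_of_steps i sigma n : traces_of trans (i, sigma) ->
  steps trans n (sigma (i - n%:Z)) (sigma i).
Proof.
move=> Ms; exists (fun j => sigma (i - n%:Z + j%:Z)).
split=> [||j _]; rewrite ?addr0 ?subrK //.
by rewrite -addn1 PoszD addrA; exact: Ms.
Qed.

Lemma steps_traces_of k q t : total_transition trans -> steps trans k q t ->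
  exists sigma, [/\ traces_of trans (0, sigma), sigma 0 = q & sigma k = t].
Proof.
move=> [/choice[f fP] /choice[g gP]] [p [p0 pk pP]].
(* Predecessors of [q] before time 0, the path up to [k], then successors of [t]. As [Negz n] is
   [-(n+1)], it takes [n.+1] predecessor steps. *)
pose sigma z := match z with
  | Posz n => if (n <= k)%N then p n else iter (n - k) f t
  | Negz n => iter n.+1 g q
  end.
exists sigma; split; rewrite /sigma /= ?leqnn //.
have NegzS n : Negz n.+1 + 1 = Negz n.
  by rewrite !NegzE -[n.+2]addn1 PoszD opprD subrK.
rewrite /traces_of /= => -[n|[|n]].
- rewrite -PoszD addn1; case: (ltngtP n k) => [nk|nk|->].
  + exact: pP.
  + by rewrite subSn 1?ltnW // iterS.
  + by rewrite subSnn pk.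
- by rewrite /= p0.
- by rewrite NegzS.
Qed.

End TransitionTraces.

Theorem theorem7 (State : Type) (trans : State -> State -> Prop)
    (htotal : total_transition trans) (S : set State) :
  complete_core (@next_trace State) (rho_forall (traces_of trans))
      (gamma_forall (traces_of trans) S)
    <> gamma_forall (traces_of trans) S
  <->
  exists (k : nat) (q r t : State),
    [/\ (0 < k)%N, S q, ~ S r, steps trans k q t & steps trans k r t].
Proof.
have fixP := complete_core_fixP (gamma_forall (traces_of trans) S)
  (rho_forall_uco (traces_of trans)).
split=> [nfix|[k [q [r [t [_ Sq nSr qt rt]]]]] /fixP fix_k].
  apply: contra_notP nfix => npath; apply/fixP => n [i sigma] [/= Ms Ss].
  split=> // -[j tau] [Mt /= Et]; split=> //=.
  apply: contra_notP npath => nSt.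
  have nst : steps trans n (tau (j - n%:Z)) (sigma i).
    by rewrite -Et; exact: traces_of_steps Mt.
  exists n, (sigma (i - n%:Z)), (tau (j - n%:Z)), (sigma i); split=> //.
  (* For [n = 0] both states are the common present state, which lies in [S]. *)
  - rewrite lt0n; apply: contra_notN nSt => /eqP n0.
    by move: Ss; rewrite n0 !subr0 Et.
  - exact: (@traces_of_steps _ _ i).
have [sigma [Ms s0 sk]] := steps_traces_of htotal qt.
have [tau [Mt t0 tk]] := steps_traces_of htotal rt.
(* At time [k] both traces are in [t], while [k] steps earlier only [sigma] is in [S]. *)
have [|_] := fix_k k (k%:Z, sigma).
  by split=> //=; rewrite subrr s0.
move=> /(_ (k%:Z, tau)) [|_ /=]; first by split=> //=; rewrite tk sk.
by rewrite subrr t0.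
Qed.
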